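(* For every prime $q$ for which $\mu_q\left(C(P^{(0)},\frac{1}{\Delta^{(0)}}S^{(0)})\right)$ makes sense, \[\mu_q\left(C\Big(P^{(0)},\tfrac{1}{\Delta^{(0)}}S^{(0)}\Big)\right)\subseteq C\Big(P^{(q)},\tfrac{1}{\Delta^{(q)}}S^{(q)}\Big).\]
   Context: Setting in characteristic $0$: $P^{(0)}=\mathbf{Q}[x_n,\ldots,x_1]$ is a polynomial ring, $f^{(0)}(T)\in P^{(0)}[T]$ is monic in $T$, $R^{(0)}=\mathbf{Q}[y;x_n,\ldots,x_1]$, $I^{(0)}=\langle f^{(0)}(y)\rangle$, and $S^{(0)}=R^{(0)}/I^{(0)}$ is an integral domain (an integral extension of $P^{(0)}$) that carries a weight function: a map $wt: R^{(0)}\setminus I^{(0)}\to\mathbf{N}^n$ with (1) $wt(c)=0$ for nonzero constants $c$; (2) $wt(gh)=wt(g)+wt(h)$; (3) if $wt(g)=wt(h)$ then for a unique constant $c$ either $wt(g-ch)\prec_{lex}wt(g)$ or $g-ch\in I^{(0)}$. $R^{(0)}$ has the weight-over-grevlex monomial ordering (compare weights first, break ties by grevlex). ''Monic'' for an element of $R^{(0)}$ or $P^{(0)}$ means leading coefficient $1$ for the monomial ordering; $LM$ is the leading monomial. Conductor: $\Delta^{(0)}\in P^{(0)}$ is the canonical monic conductor element of $S^{(0)}$, i.e. the monic gcd of those elements lying in $P^{(0)}$ of a Gröbner basis of $\langle f,\partial f/\partial y,\partial f/\partial x_1,\ldots,\partial f/\partial x_n\rangle$ ($f=f^{(0)}(y)$)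 for a block ordering eliminating $y$; the integral closure of $S^{(0)}$ in its field of fractions is contained in $\frac{1}{\Delta^{(0)}}S^{(0)}$. For a polynomial ring $P$, an extension ring $S$ of $P$ and a nonzerodivisor $\Delta\in P$, $C(P,\frac1\Delta S)$ denotes the set of elements of $\frac{1}{\Delta}S$ (inside the total ring of fractions of $S$) that are integral over $P$. Canonical generators: $(g_j^{(0)}:0\le j\le J)$ is the canonical ordered set of polynomials in $R^{(0)}$ for $C(P^{(0)},\frac{1}{\Delta^{(0)}}S^{(0)})$: each $g_j^{(0)}$ is monic, $g_0^{(0)}=\Delta^{(0)}$, the fractions $g_j^{(0)}/\Delta^{(0)}$ generate $C(P^{(0)},\frac{1}{\Delta^{(0)}}S^{(0)})$ as a $P^{(0)}$-module, and no monomial of any $g_{j_1}^{(0)}$ is of the form $x^{\alpha}LM(g_{j_2}^{(0)})$ with $j_2\ne j_1$ and $x^\alpha$ a monomial of $P^{(0)}$. Reduction mod $q$: for a prime $q$, $\mu_q$ sends $\alpha/\beta\in\mathbf{Q}$ with $\gcd(\alpha,\beta)=1$, $q\nmid\beta$, to the class $c\in\mathbf{Z}_q$ with $c\beta\equiv\alpha \pmod q$; it is applied to polynomials coefficientwise, fixing the variables. Put $P^{(q)}=\mathbf{Z}_q[x_n,\ldots,x_1]$, $R^{(q)}=\mathbf{Z}_q[y;x_n,\ldots,x_1]$, $S^{(q)}=R^{(q)}/\langle\mu_q(f^{(0)}(y))\rangle$, $\Delta^{(q)}=\mu_q(\Delta^{(0)})$. $\mu_q\left(C(P^{(0)},\frac{1}{\Delta^{(0)}}S^{(0)})\right)$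 ''makes sense'' when $q$ divides no denominator of a (reduced) rational coefficient of $f^{(0)}(y)$, of $\Delta^{(0)}$ or of any $g_j^{(0)}$; it then denotes the $P^{(q)}$-submodule of $\frac{1}{\Delta^{(q)}}S^{(q)}$ generated by the fractions $\mu_q(g_j^{(0)})/\mu_q(\Delta^{(0)})$, $0\le j\le J$. *)

(* Defs.v *)
From mathcomp Require Import all_boot all_order all_algebra.
From mathcomp Require Export mpoly.

Set Implicit Arguments.
Unset Strict Implicit.
Unset Printing Implicit Defensive.

Import GRing.Theory.
Local Open Scope ring_scope.

(* Conventions.  P = {mpoly F[n]} with 'X_0, ..., 'X_(n-1) standing for
   x_1, ..., x_n, and R = {mpoly F[n.+1]} has the additional, last variable
   'X_ord_max standing for y; P sits inside R through mwiden.  A polynomial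
   f(T) in P[T] is a {poly {mpoly F[n]}}; f(y) in R is mmulti f, and muni is
   the canonical isomorphism from R to P[y], inverse to mmulti. *)

Section MonomialOrders.
Variable N : nat.

(* Index 0 is the most significant one. *)
Definition lexlt (u v : 'I_N -> nat) : bool :=
  [exists i : 'I_N, (u i < v i)%N && [forall j : 'I_N, (j < i)%N ==> (u j == v j)]].

(* The variable of index 0 is the smallest, so that for N = n.+1 the variables
   are ordered as y > x_n > ... > x_1. *)
Definition grevlex (m1 m2 : 'X_{1..N}) : bool :=
  (mdeg m1 < mdeg m2)%N
  || (mdeg m1 == mdeg m2) && ((m1 == m2) || lexlt m2 m1).

Definition monomial_order (le : rel 'X_{1..N}) : Prop :=
  [/\ reflexive le /\ antisymmetric le, transitive le, total le,
      forall m, le 0%MM m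
    & forall m m1 m2, le m1 m2 -> le (m1 + m)%MM (m2 + m)%MM].

End MonomialOrders.

Section Ideals.
Variables (F : fieldType) (N : nat).
Implicit Types (p g : {mpoly F[N]}) (m : 'X_{1..N}) (le : rel 'X_{1..N}).

Definition ideal_gen (s : seq {mpoly F[N]}) p : Prop :=
  exists c : 'I_(size s) -> {mpoly F[N]}, p = \sum_i c i * s`_i.

(* m is LM(p); the zero polynomial has no leading monomial. *)
Definition is_lead le p m : Prop :=
  m \in msupp p /\ (forall m', m' \in msupp p -> le m' m).

Definition groebner_basis le (I : {mpoly F[N]} -> Prop)
    (G : seq {mpoly F[N]}) : Prop :=
  (forall g, g \in G -> I g) /\
  (forall p, I p -> p != 0 ->
     exists2 g, g \in G &
       exists mp mg, [/\ is_lead le p mp, is_lead le g mg & (mg <= mp)%MM]).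

Definition is_gcd (A : {mpoly F[N]} -> Prop) (d : {mpoly F[N]}) : Prop :=
  (forall p, A p -> exists h, p = h * d) /\
  (forall e, (forall p, A p -> exists h, p = h * e) -> exists h, d = h * e).

End Ideals.

Section WeightFunctions.
Variable n : nat.

Implicit Type wt : {mpoly rat[n.+1]} -> {ffun 'I_n -> nat}.

(* wt is a weight function on the complement of I; its values on I are
   unconstrained. *)
Definition weight_function (I : {mpoly rat[n.+1]} -> Prop) wt : Prop :=
  [/\ forall c : rat, c != 0 -> wt c%:MP = 0,
      forall g h, ~ I g -> ~ I h -> wt (g * h) = wt g + wt h
    & forall g h, ~ I g -> ~ I h -> wt g = wt h ->
        exists! c : rat, I (g - c *: h) \/ lexlt (wt (g - c *: h)) (wt g)].

(* For I = <f(y)> with R/I a domain, no monomial lies in I unless f(T) = T, so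
   that all weights compared here are genuine ones. *)
Definition wt_grevlex wt (m1 m2 : 'X_{1..n.+1}) : bool :=
  lexlt (wt 'X_[m1]) (wt 'X_[m2])
  || (wt 'X_[m1] == wt 'X_[m2]) && grevlex m1 m2.

Definition wt_monic wt (p : {mpoly rat[n.+1]}) : Prop :=
  exists2 m, is_lead (wt_grevlex wt) p m & p@_m = 1.

End WeightFunctions.

Section Conductor.
Variable n : nat.

(* Exponents of y are compared first.  The ties form the block of monomials in
   the x_i, up to the common power of y, which a monomial order may cancel. *)
Definition block_order_elim_y (le : rel 'X_{1..n.+1}) : Prop :=
  monomial_order le /\
  (forall m1 m2 : 'X_{1..n.+1}, (m1 ord_max < m2 ord_max)%N -> ~~ le m2 m1).

Definition jacobian_ideal (f : {poly {mpoly rat[n]}}) :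
    {mpoly rat[n.+1]} -> Prop :=
  ideal_gen (mmulti f :: [seq (mmulti f)^`M(i) | i <- enum 'I_n.+1]).

Definition canonical_conductor (f : {poly {mpoly rat[n]}})
    (wt : {mpoly rat[n.+1]} -> {ffun 'I_n -> nat})
    (Delta : {mpoly rat[n]}) : Prop :=
  wt_monic wt (mwiden Delta) /\
  exists (le : rel 'X_{1..n.+1}) (G : seq {mpoly rat[n.+1]}),
    [/\ block_order_elim_y le,
        groebner_basis le (jacobian_ideal f) G
      & is_gcd (fun p => mwiden p \in G) Delta].

End Conductor.

Section IntegralFractions.
Variables (P S : comNzRingType) (K : comUnitRingType).
Variables (phi : P -> S) (iota : S -> K).

(* K, with the ring morphism iota : S -> K, is a localization of S at the set
   of all its nonzerodivisors. *)
Definition total_fraction_ring : Prop :=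
  [/\ injective iota,
      forall s : S, GRing.lreg s -> iota s \is a GRing.unit
    & forall z : K, exists s d : S, GRing.lreg d /\ z = iota s / iota d].

(* C(P, 1/Delta S), as a subset of the total ring of fractions K of S. *)
Definition integral_fractions (Delta : P) (z : K) : Prop :=
  (exists s : S, z = iota s / iota (phi Delta)) /\ integralOver (iota \o phi) z.

Definition in_Pspan (J : nat) (v : 'I_J -> K) (z : K) : Prop :=
  exists c : 'I_J -> P, z = \sum_j iota (phi (c j)) * v j.

End IntegralFractions.

Section Quotient.
Variables (F : fieldType) (n : nat) (f : {poly {mpoly F[n]}}).
Variables (K : comUnitRingType) (iota : {poly %/ f} -> K).

(* S = R / <f(y)> is P[y] / <f> = {poly %/ f}, for f monic of positive degree;
   fraction Delta g is the class of g / Delta, for g in R. *)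
Definition fraction (Delta : {mpoly F[n]}) (g : {mpoly F[n.+1]}) : K :=
  iota (in_qpoly f (muni g)) / iota (qpolyC f Delta).

Definition C_set (Delta : {mpoly F[n]}) : K -> Prop :=
  integral_fractions (qpolyC f) iota Delta.

Definition fraction_span (Delta : {mpoly F[n]}) (J : nat)
    (g : 'I_J -> {mpoly F[n.+1]}) : K -> Prop :=
  in_Pspan (qpolyC f) iota (fun j => fraction Delta (g j)).

End Quotient.

Definition canonical_generators (n : nat) (f : {poly {mpoly rat[n]}})
    (wt : {mpoly rat[n.+1]} -> {ffun 'I_n -> nat})
    (K : comUnitRingType) (iota : {poly %/ f} -> K) (Delta : {mpoly rat[n]})
    (J : nat) (g : 'I_J.+1 -> {mpoly rat[n.+1]}) : Prop :=
  [/\ forall j, wt_monic wt (g j),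
      g ord0 = mwiden Delta,
      forall z : K, C_set iota Delta z <-> fraction_span iota Delta g z
    & forall (j1 j2 : 'I_J.+1) (m1 m2 : 'X_{1..n.+1}) (a : 'X_{1..n}),
        j2 != j1 -> m1 \in msupp (g j1) ->
        is_lead (wt_grevlex wt) (g j2) m2 -> m1 != (mnmwiden a + m2)%MM].

Section ReductionModq.
Variable q : nat.

(* For q prime, ratr a : 'F_q is (numq a) / (denq a) computed in Z_q.  It is a
   meaningful value only when q does not divide denq a. *)
Definition mu (N : nat) (p : {mpoly rat[N]}) : {mpoly 'F_q[N]} :=
  map_mpoly (ratr : rat -> 'F_q) p.

Definition mu_poly (n : nat) (f : {poly {mpoly rat[n]}}) :
    {poly {mpoly 'F_q[n]}} := map_poly (@mu n) f.

Definition denominators_prime_to (N : nat) (p : {mpoly rat[N]}) : Prop :=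
  forall m, m \in msupp p -> ~~ (q%:Z %| denq p@_m)%Z.

Definition makes_sense (n : nat) (f : {poly {mpoly rat[n]}})
    (Delta : {mpoly rat[n]}) (J : nat) (g : 'I_J -> {mpoly rat[n.+1]}) : Prop :=
  [/\ denominators_prime_to (mmulti f), denominators_prime_to Delta
    & forall j, denominators_prime_to (g j)].

End ReductionModq.

Arguments mu q {N} p.
Arguments mu_poly q {n} f.

(* Main.v *)
From HB Require Import structures.
Require Import Defs.
From mathcomp Require Import all_boot all_order all_algebra.
From mathcomp Require Import zify ring.

(** Write O for the rationals whose denominator is prime to q, so that f, Delta
    and the g_j have coefficients in O; write P = Q[x] and h = g_j / Delta.  The
    fraction h is integral over P, but the equation that witnesses this may have
    denominators divisible by q.  The point is that one particular equation
    survives reduction: the one given by the characteristic polynomial of h.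

    Let C be the companion matrix of f, M = g_j(C) the matrix of multiplication
    by g_j on P[y]/<f>, and d the degree of f.  Put chi(t) = det(Delta t - M).
    It has coefficients in O[x], its leading coefficient is Delta^d, and
    chi(h) = 0 (scaled_char_poly_root).  So the quotient chi / Delta^d, which is
    the characteristic polynomial of h, gives an integral equation for h modulo
    q as soon as it has coefficients in O[x].  This takes two steps.

    Over Q[x], Delta^d divides chi (scaled_char_poly_dvd).  Since h is integral,
    its powers have a common denominator: Delta^k h^m lies in P[y]/<f> for all
    m.  Hence so do the coefficients of Delta^k (t - h)^m, and by taking
    determinants Delta^(dm) divides Delta^(dk) chi^m in P[t] for all m.  The
    ring P[t] is completely integrally closed, by induction on leading terms
    (mpoly_cic and poly_cic), so Delta^d divides chi.

    From Q[x] to O[x], the quotient of chi by Delta^d stays q-integral because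
    Delta is monic, so that its reduction modulo q is nonzero, hence not a zero
    divisor in F_q[x] (gauss_poly).

    Finally chi commutes with ring morphisms (map_scaled_char_poly), so the
    reduction of chi / Delta^d annihilates the reduction of h
    (fraction_integral), and integral elements form a module over F_q[x]. *)

Import Order.TTheory GRing.Theory Num.Theory.
Set Implicit Arguments.
Unset Strict Implicit.
Unset Printing Implicit Defensive.
Local Open Scope ring_scope.

(** * Complete integral closedness of polynomial rings *)

(** Stated without a field of fractions: if the powers of a / b have a common
    denominator D, then a / b already lies in R. *)
Definition completely_integrally_closed (R : comNzRingType) : Prop :=
  forall D a b : R, D != 0 -> b != 0 ->
    (forall m, exists u, D * a ^+ m = b ^+ m * u) -> exists u, a = b * u.

Lemma field_cic (F : fieldType) : completely_integrally_closed F.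
Proof. by move=> D a b _ b0 _; exists (b^-1 * a); rewrite mulVKf. Qed.

(** The hypothesis of complete integral closedness depends on a only modulo b;
    this lets the two divisions below cancel leading terms one at a time. *)
Lemma dvd_powers_subM (R : comNzRingType) (D a b w : R) :
    (forall m, exists u, D * a ^+ m = b ^+ m * u) ->
  forall m, exists u, D * (a - b * w) ^+ m = b ^+ m * u.
Proof.
move=> dvd m; have [u Du] := fin_all_exists (fun i : 'I_m.+1 => dvd (m - i)%N).
exists (\sum_(i < m.+1) u i * (- w) ^+ i *+ 'C(m, i)).
rewrite exprDn !mulr_sumr; apply: eq_bigr => i _.
rewrite !mulrnAr; congr (_ *+ _).
rewrite [LHS]mulrA Du -mulrN exprMn.
have -> : b ^+ m = b ^+ (m - i) * b ^+ i by rewrite -exprD subnK ?leq_ord.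
by rewrite -!mulrA; congr (_ * _); rewrite mulrCA.
Qed.

(** Comparing degrees and leading coefficients in D * a ^+ m = b ^+ m * u shows
    that the leading term of b divides that of a; subtract and repeat. *)
Lemma poly_cic (R : idomainType) :
  completely_integrally_closed R -> completely_integrally_closed {poly R}.
Proof.
move=> cicR D a b D0 b0; move: {2}(size a) (leqnn (size a)) => n.
elim: n a => [|n IHn] a.
  rewrite size_poly_leq0 => /eqP-> _; exists 0; exact: esym (mulr0 _).
move=> le_an dvd.
have [->|a0] := eqVneq a 0; first by exists 0; rewrite mulr0.
have sz m u : D * a ^+ m = b ^+ m * u ->
    ((size D).-1 + (size a).-1 * m = (size b).-1 * m + (size u).-1)%N.
  move=> Eu; have u0 : u != 0.
    apply: contraTneq (mulf_neq0 D0 (expf_neq0 m a0)) => u0.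
    by rewrite Eu u0 mulr0 eqxx.
  move: (congr1 (fun p : {poly R} => (size p).-1) Eu).
  rewrite !size_mul ?expf_neq0 //.
  have := size_exp a m; have := size_exp b m.
  have pos (p : {poly R}) : p != 0 -> (0 < size p)%N by rewrite size_poly_gt0.
  have := pos _ (expf_neq0 m a0); have := pos _ (expf_neq0 m b0).
  have := pos _ D0; have := pos _ u0.
  move: (size (a ^+ m)) (size (b ^+ m)) (size D) (size u) => sa sb sD su.
  case: sa => // sa; case: sb => // sb uP DP _ _ /= -> ->.
  by move: (_ * m)%N (_ * m)%N => x y; lia.
(* If b had larger degree than a, the exponent m = size D would be too big. *)
have le_ba : (size b <= size a)%N.
  have [u /sz Eu] := dvd (size D).
  rewrite leqNgt; apply/negP => lt_ab.
  have a1 : (0 < size a)%N by rewrite size_poly_gt0.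
  have D1 : (0 < size D)%N by rewrite size_poly_gt0.
  have : (((size a).-1.+1) * size D <= (size b).-1 * size D)%N.
    by rewrite leq_mul2r -ltnS !prednK ?lt_ab ?orbT // (leq_trans _ lt_ab).
  rewrite mulSn => h; have : ((size D).-1 < size D)%N by rewrite prednK.
  rewrite -(ltn_add2r ((size a).-1 * size D)) Eu => h2.
  by have := leq_trans h2 h; rewrite ltnNge leq_addr.
have [c Ec] : exists c, lead_coef a = lead_coef b * c.
  apply: (cicR (lead_coef D)); rewrite ?lead_coef_eq0 // => m.
  have [u Eu] := dvd m; exists (lead_coef u).
  by rewrite -!lead_coef_exp -!lead_coefM Eu.
pose w := c *: 'X^(size a - size b).
have [] := IHn (a - b * w); last 2 first.
- exact: dvd_powers_subM.
- by move=> u /(canRL (subrK _)) ->; exists (u + w); rewrite mulrDr.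
have Ea : (size a).-1.+1 = size a by rewrite prednK // size_poly_gt0.
apply/leq_sizeP => j le_nj; rewrite coefB /w -scalerAr coefZ coefMXn.
have a1 : (0 < size a)%N by rewrite size_poly_gt0.
have b1 : (0 < size b)%N by rewrite size_poly_gt0.
have -> : (j < size a - size b)%N = false by apply/negbTE; rewrite -leqNgt; lia.
have [Ej|ne_aj] := eqVneq j (size a).-1.
  have -> : (j - (size a - size b) = (size b).-1)%N by lia.
  by rewrite Ej -!lead_coefE Ec mulrC subrr.
have lt_aj : (size a <= j)%N.
  by rewrite -Ea ltn_neqAle eq_sym ne_aj -ltnS Ea (leq_trans le_an).
rewrite [a`_j]nth_default // [b`__]nth_default ?mulr0 ?subrr //.
by rewrite subnBA // -addnBAC // leq_addl.
Qed.

(** The same argument with leading monomials: each exponent of the leading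
    monomial of b is compared with that of a as degrees were above. *)
Lemma mpoly_cic (R : idomainType) (n : nat) :
  completely_integrally_closed R -> completely_integrally_closed {mpoly R[n]}.
Proof.
move=> cicR D a b D0 b0; elim/mleadrect: a => a IHa dvd.
have [->|a0] := eqVneq a 0; first by exists 0; rewrite mulr0.
have nz m u : D * a ^+ m = b ^+ m * u -> u != 0.
  move=> Eu; apply: contraTneq (mulf_neq0 D0 (expf_neq0 m a0)) => u0.
  by rewrite Eu u0 mulr0 eqxx.
have le_ba : (mlead b <= mlead a)%MM.
  apply/mnm_lepP => i; have [u Eu] := dvd (mlead D i).+1.
  have Ei : (mlead D i + mlead a i * (mlead D i).+1
               = mlead b i * (mlead D i).+1 + mlead u i)%N.
    rewrite -!mulmnE -!mnmDE -!mleadX // -!mleadM ?expf_neq0 ?(nz _ _ Eu) //.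
    by rewrite Eu.
  rewrite leqNgt; apply/negP => lt_ab.
  by have := leq_mul lt_ab (leqnn (mlead D i).+1); rewrite mulSn; lia.
have [c Ec] : exists c, mleadc a = mleadc b * c.
  apply: (cicR (mleadc D)); rewrite ?mleadc_eq0 // => m.
  have [u Eu] := dvd m; exists (mleadc u).
  rewrite -!mleadcX -!mleadX // -!mleadcM -!mleadM ?expf_neq0 ?(nz _ _ Eu) //.
  by rewrite Eu.
pose w := c *: 'X_[mlead a - mlead b].
suff [u /(canRL (subrK _)) ->] : exists u, a - b * w = b * u.
  by exists (u + w); rewrite mulrDr.
have [->|r0] := eqVneq (a - b * w) 0; first by exists 0; rewrite mulr0.
apply: IHa; last exact: dvd_powers_subM.
have Ew : (b * w)@_(mlead a) = mleadc a.
  rewrite Ec /w -scalerAr mcoeffZ mulrC; congr (_ * _).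
  by rewrite -[X in _@_X](submK le_ba) mcoeffMX.
rewrite lt_neqAle; apply/andP; split.
  apply: contraNneq r0 => Er; rewrite -mleadc_eq0 Er mcoeffB Ew.
  by rewrite subrr.
apply: le_trans (mleadB_le _ _) _; rewrite leUx lexx /=.
apply: le_trans (mleadM_le _ _) _.
apply: (@le_trans _ _ (mlead b + (mlead a - mlead b))%MM); last first.
  by rewrite addmC submK.
by rewrite lemc_add2r; apply: le_trans (mleadZ_le _ _) _; rewrite mleadXm.
Qed.

(** * The scaled characteristic polynomial *)

(** The size is a parameter rather than read off f, so that applying a ring
    morphism to f does not change the type of the matrix. *)
Definition companion (R : comNzRingType) (d : nat) (f : {poly R}) :
    'M[R]_d.+1 :=
  \matrix_(i, j) if i == d :> nat then - f`_j else (i.+1 == j)%:R.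

Definition powers_col (R : comNzRingType) (d : nat) (y : R) : 'cV[R]_d.+1 :=
  \col_i y ^+ i.

(** The determinant of D t - g(C), with C the companion matrix of f; it is
    D ^+ d.+1 times the characteristic polynomial of g / D modulo f. *)
Definition scaled_char_poly (R : comNzRingType) (d : nat) (f : {poly R})
    (D : R) (g : {poly R}) : {poly R} :=
  char_poly (horner_mx (companion d f) g) \Po (D *: 'X).

(** The vector of powers of a root y of f is an eigenvector of the companion
    matrix for y. *)
Lemma horner_companion_powers (R : comNzRingType) (d : nat)
    (f g : {poly R}) (y : R) :
    f \is monic -> size f = d.+2 -> root f y ->
  horner_mx (companion d f) g *m powers_col d y = g.[y] *: powers_col d y.
Proof.
move=> monf szf /rootP fy.
have Cy : companion d f *m powers_col d y = y *: powers_col d y.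
  apply/colP => i; rewrite !mxE.
  have [id|ne_id] := eqVneq (i : nat) d.
    rewrite id -exprS; move: fy; rewrite horner_coef szf big_ord_recr /=.
    have -> : f`_d.+1 = 1 by move/monicP: monf; rewrite lead_coefE szf.
    move/eqP; rewrite mul1r addrC addr_eq0 => /eqP ->.
    by rewrite -sumrN; apply: eq_bigr => j _; rewrite !mxE id eqxx mulNr.
  have lt_id : (i.+1 < d.+1)%N by rewrite ltnS ltn_neqAle ne_id -ltnS ltn_ord.
  rewrite (bigD1 (Ordinal lt_id)) //= big1 ?addr0 => [|j ne_j].
    by rewrite !mxE (negPf ne_id) eqxx mul1r exprS.
  rewrite !mxE (negPf ne_id) (_ : _ == _ = false) ?mul0r //.
  by apply: contraNF ne_j => /eqP Ej; apply/eqP/val_inj.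
elim/poly_ind: g => [|g c IHg]; first by rewrite rmorph0 mul0mx horner0 scale0r.
rewrite rmorphD rmorphM /= horner_mx_X horner_mx_C hornerMXaddC mulmxDl.
rewrite -mulmxA Cy -scalemxAr IHg scalerA mul_scalar_mx scalerDl.
by rewrite [y * _]mulrC.
Qed.

Lemma map_companion (R T : comNzRingType) (j : {rmorphism R -> T}) d f :
  map_mx j (companion d f) = companion d (map_poly j f).
Proof.
apply/matrixP => i k; rewrite !mxE.
by case: ifP; rewrite ?rmorphN ?rmorph_nat ?coef_map.
Qed.

Lemma map_scaled_char_poly (R T : comNzRingType) (j : {rmorphism R -> T})
    d f D g :
  map_poly j (scaled_char_poly d f D g) =
  scaled_char_poly d (map_poly j f) (j D) (map_poly j g).
Proof.
by rewrite /scaled_char_poly map_comp_poly map_char_poly map_horner_mx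
  map_companion map_polyZ map_polyX.
Qed.

Lemma lead_scaled_char_poly (R : idomainType) d (f : {poly R}) D g :
  D != 0 -> lead_coef (scaled_char_poly d f D g) = D ^+ d.+1.
Proof.
move=> D0; rewrite lead_coef_comp ?size_scale ?size_polyX //.
rewrite (monicP (char_poly_monic _)) size_char_poly mul1r.
by rewrite lead_coefZ lead_coefX mulr1.
Qed.

Lemma scaled_char_poly_quotient_monic (R : idomainType) d (f : {poly R}) D g N :
    D != 0 -> scaled_char_poly d f D g = D ^+ d.+1 *: N -> N \is monic.
Proof.
move=> D0 EN; have := congr1 lead_coef EN.
rewrite lead_scaled_char_poly // lead_coefZ -{1}[_ ^+ _]mulr1.
by move/(mulfI (expf_neq0 _ D0)) => N1; apply/monicP.
Qed.

(** At t = g(y) / D the matrix D t - g(C) kills the vector of powers of y, whose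
    first entry is 1, so its determinant vanishes. *)
Lemma scaled_char_poly_root (R : comNzRingType) d (f : {poly R}) D g y t :
    f \is monic -> size f = d.+2 -> root f y -> D * t = g.[y] ->
  root (scaled_char_poly d f D g) t.
Proof.
move=> monf szf fy Dt; apply/rootP; rewrite horner_comp hornerZ hornerX Dt.
set M := horner_mx _ _.
have -> : (char_poly M).[g.[y]] = \det (g.[y]%:M - M).
  rewrite -[LHS]/(horner_eval _ _) -det_map_mx; congr (\det _).
  apply/matrixP => i k; rewrite !mxE.
  rewrite -[LHS]/(('X *+ (i == k) - (M i k)%:P).[g.[y]]).
  by rewrite !hornerE hornerMn hornerX.
have kerV : (g.[y]%:M - M) *m powers_col d y = 0.
  by rewrite mulmxBl mul_scalar_mx horner_companion_powers // subrr.
have /(congr1 (mulmx (\adj (g.[y]%:M - M)))) := kerV.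
rewrite mulmxA mul_adj_mx mulmx0 mul_scalar_mx => /colP /(_ ord0).
by rewrite !mxE expr0 mulr1.
Qed.

Lemma in_qpolyC (R : nzRingType) (f : {poly R}) c :
  in_qpoly f c%:P = qpolyC f c.
Proof.
apply/val_inj; rewrite /= Pdiv.CommonRing.rmodp_small //.
by rewrite (leq_ltn_trans (size_polyC_leq1 _)) ?size_mk_monic_gt1.
Qed.

Section QuotientFacts.
Variables (R : comNzRingType) (d : nat) (f : {poly R}).
Hypotheses (monf : f \is monic) (szf : size f = d.+2).

Lemma mk_monic_id : mk_monic f = f.
Proof. by rewrite /mk_monic szf monf. Qed.

Lemma horner_qpolyC p : (map_poly (qpolyC f) p).[in_qpoly f 'X] = in_qpoly f p.
Proof.
elim/poly_ind: p => [|p c IHp]; first by rewrite !rmorph0 horner0.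
rewrite !rmorphD !rmorphM /= map_polyX map_polyC hornerMXaddC IHp.
by rewrite in_qpolyC.
Qed.

Lemma in_qpoly_modulus : in_qpoly f f = 0.
Proof. by apply/val_inj; rewrite /= mk_monic_id Pdiv.RingMonic.rmodpp. Qed.

Lemma root_in_qpolyX : root (map_poly (qpolyC f) f) (in_qpoly f 'X).
Proof. by apply/rootP; rewrite horner_qpolyC in_qpoly_modulus. Qed.

(** The matrix p(C) multiplies the vector of powers of the class of y by p(y),
    and those powers are linearly independent over R. *)
Lemma horner_companion_eq0 p :
  in_qpoly f p = 0 -> horner_mx (companion d f) p = 0.
Proof.
move=> p0; set M := horner_mx _ _.
have : map_mx (qpolyC f) M *m powers_col d (in_qpoly f 'X) = 0.
  rewrite /M map_horner_mx map_companion.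
  rewrite horner_companion_powers ?horner_qpolyC //.
  - by rewrite p0 scale0r.
  - exact: monic_map.
  - by rewrite size_map_poly_id0 // (monicP monf) rmorph1 oner_neq0.
  - exact: root_in_qpolyX.
move/colP => Mv; apply/matrixP => i j; rewrite [RHS]mxE.
pose r := \poly_(k < d.+1) M i (inord k).
have : in_qpoly f r = 0.
  have := Mv i; rewrite !mxE => <-; rewrite /r poly_def rmorph_sum.
  apply: eq_bigr => k _; rewrite !mxE inord_val -rmorphXn /= -mul_polyC rmorphM.
  by rewrite /= in_qpolyC.
move/(congr1 (fun q : {poly %/ f} => (q : {poly R})`_j)).
rewrite in_qpoly_small; last by rewrite mk_monic_id szf ltnS size_poly.
by rewrite coef_poly ltn_ord inord_val coef0.
Qed.

End QuotientFacts.

(** Dividing T ^+ m by an integral equation of degree k writes the m-th power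
    of s / D as a combination of its powers below k, which D ^+ k clears. *)
Lemma integral_power_denominators (R S : comNzRingType) (K : comUnitRingType)
    (phi : {rmorphism R -> S}) (iota : {rmorphism S -> K}) (D : R) (s : S) :
    injective iota -> iota (phi D) \is a GRing.unit ->
    integralOver (iota \o phi) (iota s / iota (phi D)) ->
  exists k, forall m, exists c : 'I_k -> R,
    phi D ^+ k * s ^+ m = phi D ^+ m * \sum_(i < k) phi (c i) * s ^+ i.
Proof.
move=> inj_iota Du [p monp pz]; exists (size p).-1 => m.
set z := _ / _ in pz.
have zD : z * iota (phi D) = iota s by rewrite divrK.
clearbody z.
pose r := Pdiv.CommonRing.rmodp 'X^m p.
have szr : (size r <= (size p).-1)%N.
  have sp : (0 < size p)%N by rewrite size_poly_gt0 monic_neq0.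
  by rewrite -ltnS prednK // Pdiv.CommonRing.ltn_rmodpN0 // monic_neq0.
have zm : z ^+ m = \sum_(i < (size p).-1) iota (phi r`_i) * z ^+ i.
  have := congr1 (fun q => (map_poly (iota \o phi) q).[z])
             (Pdiv.RingMonic.rdivp_eq monp 'X^m).
  rewrite map_polyXn hornerXn => ->; rewrite rmorphD rmorphM hornerD hornerM.
  rewrite (rootP pz) mulr0 add0r -/r (horner_coef_wide _ (n := (size p).-1)).
    by apply: eq_bigr => i _; rewrite coef_map.
  exact: leq_trans (size_poly _ _) szr.
exists (fun i => r`_i * D ^+ ((size p).-1 - i)); apply: inj_iota.
rewrite !rmorphM !rmorphXn -zD exprMn mulrA mulrC; congr (_ * _).
rewrite zm mulr_sumr rmorph_sum; apply: eq_bigr => i _.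
rewrite !rmorphM !rmorphXn -zD exprMn.
have -> : iota (phi D) ^+ (size p).-1 =
          iota (phi D) ^+ ((size p).-1 - i) * iota (phi D) ^+ i.
  by rewrite -exprD subnK // ltnW.
by rewrite mulrACA; congr (_ * _); exact: mulrC.
Qed.

Lemma det_exp (R : comNzRingType) n (A : 'M[R]_n.+1) m :
  \det (A ^+ m) = \det A ^+ m.
Proof. by elim: m => [|m IHm]; rewrite ?det1 // !exprS detM IHm. Qed.

Lemma scaled_char_polyE (R : comNzRingType) d (f : {poly R}) D g :
  scaled_char_poly d f D g =
  \det ((D *: 'X)%:M - map_mx polyC (horner_mx (companion d f) g)).
Proof.
rewrite /scaled_char_poly /char_poly -[LHS]/(comp_poly _ _) -det_map_mx.
congr (\det _); apply/matrixP => i j; rewrite !mxE.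
by rewrite raddfB raddfMn /= comp_polyX comp_polyC.
Qed.

(** The matrix X = D t - M behaves as D (t - h) with h = g / D: by integrality
    of h, D ^+ m divides D ^+ k *: X ^+ m entrywise for all m.  Determinants
    turn this into the hypothesis of complete integral closedness of R[t]. *)
Lemma scaled_char_poly_dvd (R : idomainType) (K : comUnitRingType) (d : nat)
    (f : {poly R}) (iota : {rmorphism {poly %/ f} -> K}) (D : R)
    (g : {poly R}) :
    completely_integrally_closed R ->
    f \is monic -> size f = d.+2 -> injective iota -> D != 0 ->
    iota (qpolyC f D) \is a GRing.unit ->
    integralOver (iota \o qpolyC f) (iota (in_qpoly f g) / iota (qpolyC f D)) ->
  exists N, scaled_char_poly d f D g = D ^+ d.+1 *: N.
Proof.
move=> cicR monf szf inj_iota D0 Du intg.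
have [k pow_g] := integral_power_denominators inj_iota Du intg.
pose M := horner_mx (companion d f) g.
have pow_M m : exists U, D ^+ k *: M ^+ m = D ^+ m *: U.
  have [c Ec] := pow_g m; exists (\sum_(i < k) c i *: M ^+ i).
  suff /(horner_companion_eq0 monf szf) :
      in_qpoly f (D ^+ k *: g ^+ m - D ^+ m *: \sum_(i < k) c i *: g ^+ i) = 0.
    rewrite rmorphB /= !horner_mxZ rmorphXn /= rmorph_sum.
    move/eqP; rewrite subr_eq0 => /eqP ->; congr (_ *: _).
    by apply: eq_bigr => i _; rewrite /= horner_mxZ rmorphXn.
  apply/eqP; rewrite rmorphB subr_eq0 /=; apply/eqP.
  have qC a p : in_qpoly f (a *: p) = qpolyC f a * in_qpoly f p.
    by rewrite -mul_polyC rmorphM /= in_qpolyC.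
  rewrite !qC !rmorphXn /= Ec; congr (_ * _).
  by rewrite rmorph_sum; apply: eq_bigr => i _; rewrite /= qC rmorphXn.
have Dn j : D%:P ^+ j != 0 :> {poly R} by rewrite expf_neq0 ?polyC_eq0.
suff [N ->] : exists N, scaled_char_poly d f D g = D%:P ^+ d.+1 * N.
  by exists N; rewrite -mul_polyC rmorphXn.
apply: (poly_cic cicR (Dn (k * d.+1)%N) (Dn d.+1)).
move=> m.
pose X : 'M[{poly R}]_d.+1 := (D *: 'X)%:M - map_mx polyC M.
have [U Em] := fin_all_exists (fun i : 'I_m.+1 => pow_M i).
have [Y EY] : exists Y, D%:P ^+ k *: X ^+ m = D%:P ^+ m *: Y.
  exists (\sum_(i < m.+1)
    ('X ^+ (m - i) * (- 1) ^+ i *+ 'C(m, i)) *: map_mx polyC (U i)).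
  rewrite exprDn_comm; last exact: comm_scalar_mx.
  rewrite !scaler_sumr; apply: eq_bigr => i _.
  have Ei :
      D%:P ^+ k *: map_mx polyC M ^+ i = D%:P ^+ i *: map_mx polyC (U i).
    by rewrite -rmorphXn -!rmorphXn /= -!map_mxZ -Em /M rmorphXn.
  have -> : (D *: 'X)%:M ^+ (m - i) * (- map_mx polyC M) ^+ i =
            ((D *: 'X) ^+ (m - i) * (-1) ^+ i) *: map_mx polyC M ^+ i.
    by rewrite -[- _]scaleN1r exprZn -rmorphXn -scalerA -mul_scalar_mx.
  rewrite scalerMnl scalerA mulrC -scalerA Ei !scalerA; congr (_ *: _).
  have -> : D%:P ^+ m = D%:P ^+ (m - i) * D%:P ^+ i.
    by rewrite -exprD subnK ?leq_ord.
  rewrite -mul_polyC exprMn mulrnAl mulrnAr; congr (_ *+ _).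
  by rewrite -!mulrA; congr (_ * _); rewrite mulrA mulrC.
exists (\det Y).
rewrite exprM scaled_char_polyE -/M -/X -det_exp -detZ EY detZ.
by rewrite -exprM mulnC exprM.
Qed.

(** * Rational numbers with denominator prime to q *)

Lemma denq_dvd (x : rat) (a b : int) : x * b%:~R = a%:~R -> (denq x %| b)%Z.
Proof.
move=> xb; have : (denq x %| numq x * b)%Z.
  apply/dvdzP; exists a; apply: (@intr_inj rat).
  by rewrite !rmorphM /= numqE mulrAC xb.
by rewrite Gauss_dvdzr // coprimez_sym; exact: coprime_num_den.
Qed.

Definition q_integral (q : nat) : pred rat := fun x => coprime `|denq x|%N q.

(** A fraction need not be reduced to witness that its denominator can be taken
    prime to q; this form is stable under the ring operations. *)
Lemma q_integralP (q : nat) (x : rat) :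
  reflect
    (exists2 b : int, coprime `|b|%N q & exists a : int, x * b%:~R = a%:~R)
    (q_integral q x).
Proof.
apply: (iffP idP) => [qx | [b qb [a xb]]].
  by exists (denq x) => //; exists (numq x); rewrite numqE.
exact: coprime_dvdl (denq_dvd xb) qb.
Qed.

Lemma q_integral_subring_closed q : subring_closed (q_integral q).
Proof.
have cop (b c : int) :
    coprime `|b|%N q -> coprime `|c|%N q -> coprime (absz (b * c)) q.
  by rewrite abszM coprimeMl => -> ->.
split=> [|x y|x y]; rewrite -?[_ \in _]/(q_integral _ _).
- by rewrite /q_integral (denq_int 1) coprime1n.
- move=> /q_integralP[b qb [a xb]] /q_integralP[c qc [e yc]].
  apply/q_integralP; exists (b * c); first exact: cop.
  exists (a * c - e * b); rewrite rmorphB !rmorphM /= -xb -yc mulrBl.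
  rewrite mulrA [in RHS]mulrAC.
  by congr (_ - _); rewrite -!mulrA; congr (_ * _); rewrite mulrC.
move=> /q_integralP[b qb [a xb]] /q_integralP[c qc [e yc]].
apply/q_integralP; exists (b * c); first exact: cop.
by exists (a * e); rewrite !rmorphM /= -xb -yc mulrACA.
Qed.

HB.instance Definition _ q :=
  GRing.isSubringClosed.Build rat (q_integral q) (q_integral_subring_closed q).

Record zloc (q : nat) := Zloc { zloc_val :> rat; _ : q_integral q zloc_val }.
HB.instance Definition _ q := [isSub for @zloc_val q].
HB.instance Definition _ q := [Choice of zloc q by <:].
HB.instance Definition _ q := [SubChoice_isSubComNzRing of zloc q by <:].

Section ReductionMorphism.
Variables (q : nat) (q_prime : prime q).

Lemma intr_Fp_neq0 (b : int) : coprime `|b|%N q -> b%:~R != 0 :> 'F_q.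
Proof.
by rewrite coprime_sym prime_coprime // -(dvdz_pcharf (pchar_Fp q_prime)).
Qed.

Lemma ratr_zloc (x : zloc q) (a b : int) :
    zloc_val x * b%:~R = a%:~R -> coprime `|b|%N q ->
  ratr (zloc_val x) = a%:~R / b%:~R :> 'F_q.
Proof.
move=> xb qb; rewrite /ratr; apply/eqP.
rewrite eqr_div ?intr_Fp_neq0 //; last exact: (valP x).
rewrite -!rmorphM /=; apply/eqP; congr (_%:~R); apply: (@intr_inj rat).
by rewrite !rmorphM /= numqE mulrAC xb.
Qed.

(** The primality proof is an argument so that the ring morphism structure,
    which depends on it, can be inferred from the function. *)
Definition zred of prime q := fun x : zloc q => ratr (zloc_val x) : 'F_q.

Local Notation red := (zred q_prime).

Lemma zredP (x : zloc q) : exists a b : int,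
  [/\ coprime `|b|%N q, zloc_val x * b%:~R = a%:~R & red x = a%:~R / b%:~R].
Proof.
by exists (numq (zloc_val x)), (denq (zloc_val x)); split;
  [exact: (valP x) | rewrite numqE |].
Qed.

Fact zred_zmod : zmod_morphism red.
Proof.
move=> x y; have [a [b [qb xb ->]]] := zredP x.
have [c [e [qe ye ->]]] := zredP y.
rewrite -mulNr addf_div ?intr_Fp_neq0 //.
rewrite -!rmorphN -!rmorphM -rmorphD.
apply: ratr_zloc; last by rewrite abszM coprimeMl qb.
rewrite /= rmorphD !rmorphM rmorphN /= -xb -ye; ring.
Qed.

Fact zred_monoid : monoid_morphism red.
Proof.
split=> [|x y]; first by rewrite /zred (@ratr_zloc 1 1 1) ?coprime1n ?divr1.
have [a [b [qb xb ->]]] := zredP x.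
have [c [e [qe ye ->]]] := zredP y.
rewrite mulf_div -!rmorphM; apply: ratr_zloc.
  2: by rewrite abszM coprimeMl qb.
by rewrite /= !rmorphM /= -xb -ye mulrACA.
Qed.

HB.instance Definition _ :=
  GRing.isZmodMorphism.Build (zloc q) 'F_q red zred_zmod.
HB.instance Definition _ :=
  GRing.isMonoidMorphism.Build (zloc q) 'F_q red zred_monoid.

End ReductionMorphism.

(** * Separating the last variable of a polynomial *)

Section Univariate.
Variable n : nat.

Lemma mcoeff_sumX (R : nzRingType) N (r : seq 'X_{1..N})
    (c : 'X_{1..N} -> R) m :
    uniq r -> (m \notin r -> c m = 0) ->
  (\sum_(m' <- r) c m' *: 'X_[m'])@_m = c m.
Proof.
move=> ur cm0; rewrite raddf_sum /=; have [rm|nrm] := boolP (m \in r).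
  rewrite (bigD1_seq m) //= mcoeffZ mcoeffX eqxx mulr1.
  rewrite big1 ?addr0 // => m' /negPf ne.
  by rewrite mcoeffZ mcoeffX ne mulr0.
rewrite cm0 // big_seq big1 // => m' rm'; rewrite mcoeffZ mcoeffX.
by case: eqP rm' => [->|]; rewrite ?(negPf nrm) ?mulr0.
Qed.

Lemma eq_mnm_rcons (m' : 'X_{1..n.+1}) (m : 'X_{1..n}) k :
  (m' == [multinom of rcons m k])
  = (m' ord_max == k)
    && ([multinom m' (widen_ord (leqnSn n) i) | i < n] == m).
Proof.
set mk := [multinom of rcons m k].
have mk_max : mk ord_max = k.
  by rewrite multinomE (tnth_nth 0%N) /= nth_rcons size_tuple ltnn eqxx.
have mk_widen i : mk (widen_ord (leqnSn n) i) = m i.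
  rewrite multinomE (tnth_nth 0%N) /= nth_rcons size_tuple ltn_ord.
  by rewrite -mnm_nth.
apply/eqP/andP => [->|[/eqP Ek /eqP Em]].
  rewrite mk_max eqxx; split=> //.
  by apply/eqP/mnmP => i; rewrite mnmE mk_widen.
apply/mnmP => i; have [j ->|->] := unliftP ord_max i; last by rewrite mk_max.
have -> : lift ord_max j = widen_ord (leqnSn n) j.
  by apply: val_inj; exact: lift_max.
by rewrite mk_widen -Em mnmE.
Qed.

Lemma mcoeff_muni (R : nzRingType) (p : {mpoly R[n.+1]}) k (m : 'X_{1..n}) :
  (muni p)`_k@_m = p@_[multinom of rcons m k].
Proof.
rewrite muniE coef_sum raddf_sum /=.
rewrite -[RHS](@mcoeff_sumX _ _ (msupp p) (fun m => p@_m)) //.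
  rewrite raddf_sum /=; apply: eq_bigr => m' _.
  rewrite coefZ coefXn mcoeffZ mcoeffX eq_mnm_rcons eq_sym.
  case: (m' ord_max == k); last by rewrite mulr0 mcoeff0 mulr0.
  by rewrite mulr1 mcoeffZ mcoeffX.
by move=> /memN_msupp_eq0.
Qed.

Lemma muniX (R : nzRingType) (m : 'X_{1..n.+1}) :
  muni ('X_[m] : {mpoly R[n.+1]})
  = 'X_[[multinom m (widen_ord (leqnSn n) i) | i < n]] *: 'X^(m ord_max).
Proof. by rewrite muniE msuppX big_seq1 mcoeffX eqxx scale1r. Qed.

Lemma muni_mwiden (R : nzRingType) (p : {mpoly R[n]}) : muni (mwiden p) = p%:P.
Proof.
rewrite [p in RHS]mpolyE !raddf_sum /=; apply: eq_bigr => m _.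
rewrite mul_mpolyC -(mmapX _ (@mpolyC n.+1 R)) -[mmap _ _ _]/(mwiden _).
rewrite mwidenX muniZ muniX mnmwiden_ordmax expr0.
rewrite -[in RHS]mul_mpolyC polyCM -!mul_polyC mulr1; congr (_ * _%:P).
by congr 'X_[_]; apply/mnmP => i; rewrite mnmE mnmwiden_widen.
Qed.

Lemma muni_Xmax (R : nzRingType) : muni ('X_ord_max : {mpoly R[n.+1]}) = 'X.
Proof.
rewrite muniX mnm1E eqxx expr1 -[RHS]scale1r -mpolyX0; congr ('X_[_] *: _).
by apply/mnmP => i; rewrite !mnmE -val_eqE /= gtn_eqF.
Qed.

Lemma mmultiK (R : comNzRingType) (f : {poly {mpoly R[n]}}) :
  muni (mmulti f) = f.
Proof.
rewrite -[RHS]coefK poly_def raddf_sum /=; apply: eq_bigr => i _.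
by rewrite muniM rmorphXn /= muni_mwiden muni_Xmax mul_polyC.
Qed.

Lemma muni_map (R S : nzRingType) (j : {rmorphism R -> S})
    (p : {mpoly R[n.+1]}) :
  muni (map_mpoly j p) = map_poly (map_mpoly j) (muni p).
Proof.
apply/polyP => k; apply/mpolyP => m.
by rewrite coef_map /= !(mcoeff_muni, mcoeff_map_mpoly).
Qed.

End Univariate.

(** * Reduction modulo q and Gauss's lemma *)

Local Notation mval q := (map_mpoly (\val : zloc q -> rat)).
Local Notation mred q_prime := (map_mpoly (zred q_prime)).

Section Reduction.
Variables (q : nat) (q_prime : prime q).

Lemma mvalZn N (a : {mpoly (zloc q)[N]}) :
  mval q (q%:R *: a) = q%:R *: mval q a.
Proof. by rewrite !scaler_nat raddfMn. Qed.

Lemma mval_inj N : injective (mval q : {mpoly (zloc q)[N]} -> {mpoly rat[N]}).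
Proof.
move=> a b Eab; apply/mpolyP => m; apply: val_inj.
by rewrite -!mcoeff_map_mpoly Eab.
Qed.

Lemma mval_lift N (p : {mpoly rat[N]}) :
  (forall m, q_integral q p@_m) -> exists a, mval q a = p.
Proof.
move=> qp; pose c m := insubd (0 : zloc q) p@_m.
have [a Ea] : exists a : {mpoly (zloc q)[N]}, forall m, a@_m = c m.
  exists (\sum_(m <- msupp p) c m *: 'X_[m]) => m.
  rewrite mcoeff_sumX ?msupp_uniq // => /memN_msupp_eq0 pm0.
  by apply: val_inj; rewrite /c insubdK ?pm0 // -pm0; exact: qp.
exists a; apply/mpolyP => m; rewrite [LHS]mcoeff_map_mpoly Ea.
by rewrite /= insubdK //; exact: qp.
Qed.

Lemma denominators_prime_to_lift N (p : {mpoly rat[N]}) :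
  denominators_prime_to q p -> exists a, mval q a = p.
Proof.
move=> qp; apply: mval_lift => m.
have [/qp|/memN_msupp_eq0->] := boolP (m \in msupp p).
  by rewrite /q_integral coprime_sym prime_coprime.
by rewrite /q_integral (denq_int 0) coprime1n.
Qed.

Lemma mu_mval N (a : {mpoly (zloc q)[N]}) : mu q (mval q a) = mred q_prime a.
Proof.
have -> : mu q (mval q a) =
    \sum_(m' <- msupp (mval q a)) (ratr (mval q a)@_m' : 'F_q) *: 'X_[m'].
  by apply: eq_bigr => m' _; rewrite mmap1_id mul_mpolyC.
apply/mpolyP => m; rewrite [RHS]mcoeff_map_mpoly.
rewrite mcoeff_sumX ?msupp_uniq ?mcoeff_map_mpoly // => /memN_msupp_eq0.
by rewrite mcoeff_map_mpoly => ->; rewrite /ratr mul0r.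
Qed.

Lemma zred_eq0 (x : zloc q) :
  zred q_prime x = 0 -> q_integral q (q%:R^-1 * \val x).
Proof.
have [a [b [qb xb ->]]] := zredP q_prime x => /eqP.
rewrite mulf_eq0 invr_eq0 (negPf (intr_Fp_neq0 q_prime qb)) orbF.
rewrite -(dvdz_pcharf (pchar_Fp q_prime)) => /dvdzP[c Ec].
apply/q_integralP; exists b => //; exists c.
rewrite -mulrA xb Ec rmorphM /= mulrC mulfK //.
by rewrite pnatr_eq0 -lt0n prime_gt0.
Qed.

(** One factor q can be removed from the denominators of c: modulo q, the
    product of b with the numerator c1 of c vanishes and b does not. *)
Lemma gauss_descent (F : fieldType) (red : {rmorphism zloc q -> F}) N
    (b a c1 : {mpoly (zloc q)[N]}) (c : {mpoly rat[N]}) :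
    red q%:R = 0 ->
    (forall x, red x = 0 -> q_integral q (q%:R^-1 * \val x)) ->
    map_mpoly red b != 0 -> mval q b * c = mval q a -> q%:R *: c = mval q c1 ->
  exists c', mval q c' = c.
Proof.
move=> redq red0 b0 Ea Ec1; have Eb : b * c1 = q%:R *: a.
  by apply: mval_inj; rewrite mvalZn rmorphM /= -Ec1 -scalerAr Ea.
have c10 : map_mpoly red c1 = 0.
  apply/eqP; move/eqP: (congr1 (map_mpoly red) Eb).
  by rewrite rmorphM map_mpolyZ redq scale0r mulf_eq0 (negPf b0).
have q0 : q%:R != 0 :> rat by rewrite pnatr_eq0 -lt0n prime_gt0.
apply: mval_lift => m.
have -> : c@_m = q%:R^-1 * \val c1@_m.
  by rewrite -mcoeff_map_mpoly -Ec1 mcoeffZ mulKf.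
by apply: red0; rewrite -mcoeff_map_mpoly c10 mcoeff0.
Qed.

(** Multiplying c by its denominators makes it integral, and the part of this
    product prime to q can be divided out again. *)
Lemma mval_pow N (c : {mpoly rat[N]}) : exists e a, q%:R ^+ e *: c = mval q a.
Proof.
pose d := (\prod_(m <- msupp c) `|denq c@_m|)%N.
have d0 : (0 < d)%N by rewrite prodn_gt0 // => m; rewrite absz_gt0 denq_neq0.
have dc m : exists z : int, d%:R * c@_m = z%:~R.
  have [sm|/memN_msupp_eq0->] := boolP (m \in msupp c); last first.
    by exists 0; rewrite mulr0.
  have /dvdnP[k ->] : (`|denq c@_m| %| d)%N.
    by rewrite /d (bigD1_seq m) //= ?dvdn_mulr // msupp_uniq.
  exists (k%:Z * numq c@_m).
  rewrite intrM numqE natrM -mulrA [_ * c@_m]mulrC; congr (_ * (_ * _)).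
  by rewrite -{2}[denq _]gez0_abs ?denq_ge0.
exists (logn q d).
suff /mval_lift[a <-] : forall m, q_integral q (q%:R ^+ logn q d *: c)@_m.
  by exists a.
move=> m; have [z Ez] := dc m; apply/q_integralP; exists (d`_(q^'))%:Z.
  rewrite absz_nat coprime_sym prime_coprime //.
  by rewrite -p'natE // part_pnat.
exists z; rewrite mcoeffZ -Ez -[X in X%:R * _](partnC q d0) p_part natrM natrX.
by rewrite mulrAC pmulrn.
Qed.

(** Induction on the power of q that clears the denominators of c; each step
    removes one factor q. *)
Lemma gauss N (b a : {mpoly (zloc q)[N]}) (c : {mpoly rat[N]}) :
  mred q_prime b != 0 -> mval q b * c = mval q a -> exists c', mval q c' = c.
Proof.
move=> b0; have [e [c1]] := mval_pow c.
elim: e c c1 a => [|e IHe] c c1 a.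
  by rewrite expr0 scale1r => ->; exists c1.
rewrite exprSr -scalerA => Ec1 Ea.
have [|c2 Ec2] := IHe (q%:R *: c) c1 (q%:R *: a) Ec1.
  by rewrite -scalerAr Ea mvalZn.
have redq : zred q_prime q%:R = 0.
  by rewrite (rmorph_nat (zred q_prime)) pchar_Fp_0.
exact: gauss_descent redq zred_eq0 b0 Ea (esym Ec2).
Qed.

(** The leading coefficient 1 of a monic polynomial survives reduction. *)
Lemma mred_wt_monic_neq0 n (wt : {mpoly rat[n.+1]} -> {ffun 'I_n -> nat})
    (a : {mpoly (zloc q)[n]}) :
  wt_monic wt (mwiden (mval q a)) -> mred q_prime a != 0.
Proof.
move=> [m _]; pose m0 := [multinom m (widen_ord (leqnSn n) i) | i < n].
have -> : m = [multinom of rcons m0 (m ord_max)].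
  by apply/eqP; rewrite eq_mnm_rcons !eqxx.
rewrite -mcoeff_muni muni_mwiden coefC; case: eqP => [_|_ /eqP]; last first.
  by rewrite mcoeff0 eq_sym oner_eq0.
rewrite mcoeff_map_mpoly => a1; apply: contraTneq (oner_neq0 'F_q) => ra0.
have Ea : a@_m0 = 1 by apply: val_inj.
by rewrite negbK -(rmorph1 (zred q_prime)) -Ea -mcoeff_map_mpoly ra0 mcoeff0.
Qed.

Lemma gauss_poly n (b : {mpoly (zloc q)[n]}) (a : {poly {mpoly (zloc q)[n]}})
    (c : {poly {mpoly rat[n]}}) :
    mred q_prime b != 0 -> mval q b *: c = map_poly (mval q) a ->
  exists c', a = b *: c'.
Proof.
move=> b0 Ea.
have lift (i : 'I_(size c)) : exists c', mval q c' = c`_i.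
  by apply: (@gauss _ b a`_i); rewrite // -coefZ Ea coef_map.
have [c' Ec'] := fin_all_exists lift.
have cE : map_poly (mval q) (\poly_(i < size c) oapp c' 0 (insub i)) = c.
  apply/polyP => i; rewrite coef_map coef_poly; case: ltnP => [lt_ic|le_ci].
    by rewrite insubT /= Ec'.
  by rewrite nth_default //; exact: (raddf0 (mval q)).
exists (\poly_(i < size c) oapp c' 0 (insub i)).
apply/polyP => i; apply: (@mval_inj); rewrite coefZ rmorphM /=.
by rewrite -!(coef_map (mval q)) cE -Ea coefZ.
Qed.

End Reduction.

(** * Integrality of the reduced generators *)

Lemma qpolyC_lreg (R : idomainType) (f : {poly R}) (c : R) :
  c != 0 -> GRing.lreg (qpolyC f c).
Proof.
move=> c0 u v /(congr1 (fun p : {poly %/ f} => (p : {poly R}))) /=.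
have small (w : {poly %/ f}) :
    (size ((c%:P * w)%R : {poly R}) < size (mk_monic f))%N.
  by rewrite mul_polyC size_scale // size_mk_monic.
rewrite !Pdiv.CommonRing.rmodp_small // => /mulfI Euv; apply: val_inj.
by apply: Euv; rewrite polyC_eq0.
Qed.

(** Here N is the characteristic polynomial of g / D modulo f: it kills g / D
    because the scaled polynomial does and D becomes invertible in K. *)
Lemma fraction_integral (R : comNzRingType) (d : nat) (f : {poly R})
    (K : comUnitRingType)
    (iota : {rmorphism {poly %/ f} -> K}) (D : R) (g N : {poly R}) :
    f \is monic -> size f = d.+2 -> iota (qpolyC f D) \is a GRing.unit ->
    N \is monic -> scaled_char_poly d f D g = D ^+ d.+1 *: N ->
  integralOver (iota \o qpolyC f) (iota (in_qpoly f g) / iota (qpolyC f D)).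
Proof.
move=> monf szf Du monN EN; exists N => //; set z := _ / _.
pose j : {rmorphism R -> K} := iota \o qpolyC f.
have Ej p : (map_poly j p).[iota (in_qpoly f 'X)] = iota (in_qpoly f p).
  by rewrite map_poly_comp horner_map horner_qpolyC.
have : root (scaled_char_poly d (map_poly j f) (j D) (map_poly j g)) z.
  apply: (@scaled_char_poly_root _ _ _ _ _ (iota (in_qpoly f 'X))).
  - exact: monic_map.
  - by rewrite size_map_poly_id0 // (monicP monf) rmorph1 oner_neq0.
  - by apply/rootP; rewrite Ej (in_qpoly_modulus monf szf) rmorph0.
  - by rewrite Ej mulrC divrK.
rewrite -map_scaled_char_poly EN map_polyZ rmorphXn /= => /rootP.
rewrite hornerZ => /eqP Nz; apply/rootP; apply: (mulrI (unitrX d.+1 Du)).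
by rewrite mulr0; apply/eqP.
Qed.

Lemma fraction_in_span (F : fieldType) (n : nat) (f : {poly {mpoly F[n]}})
    (K : comUnitRingType) (iota : {rmorphism {poly %/ f} -> K})
    (D : {mpoly F[n]}) (J : nat) (g : 'I_J -> {mpoly F[n.+1]}) (j : 'I_J) :
  fraction_span iota D g (fraction iota D (g j)).
Proof.
exists (fun i => (i == j)%:R); rewrite (bigD1 j) //= eqxx !rmorph1 mul1r.
by rewrite big1 ?addr0 // => i /negPf->; rewrite !rmorph0 mul0r.
Qed.

Lemma C_set_of_generators (F : fieldType) (n : nat) (f : {poly {mpoly F[n]}})
    (K : comUnitRingType) (iota : {rmorphism {poly %/ f} -> K})
    (D : {mpoly F[n]}) (J : nat) (g : 'I_J -> {mpoly F[n.+1]}) (z : K) :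
    (forall j, integralOver (iota \o qpolyC f) (fraction iota D (g j))) ->
  fraction_span iota D g z -> C_set iota D z.
Proof.
move=> intg [c ->]; split.
  exists (\sum_j qpolyC f (c j) * in_qpoly f (muni (g j))).
  rewrite rmorph_sum mulr_suml; apply: eq_bigr => j _.
  by rewrite rmorphM mulrA.
pose phi : {rmorphism {mpoly F[n]} -> K} := iota \o qpolyC f.
apply: (big_ind (integralOver phi)) => [|u v|j _].
- exact: integral0.
- exact: integral_add.
by apply: integral_mul; [exact: (integral_id phi) | exact: intg].
Qed.

Theorem lemma9 (n : nat) (f : {poly {mpoly rat[n]}})
    (f_monic : f \is monic) (f_deg : (1 < size f)%N)
    (S_domain : GRing.integral_domain_axiom {poly %/ f})
    (wt : {mpoly rat[n.+1]} -> {ffun 'I_n -> nat})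
    (wtP : weight_function (ideal_gen [:: mmulti f]) wt)
    (Delta : {mpoly rat[n]})
    (DeltaP : canonical_conductor f wt Delta)
    (K : comUnitRingType) (iota : {rmorphism {poly %/ f} -> K})
    (iotaP : total_fraction_ring iota)
    (J : nat) (g : 'I_J.+1 -> {mpoly rat[n.+1]})
    (gP : canonical_generators wt iota Delta g)
    (q : nat) (q_prime : prime q)
    (q_ok : makes_sense q f Delta g)
    (Kq : comUnitRingType)
    (iotaq : {rmorphism {poly %/ mu_poly q f} -> Kq})
    (iotaqP : total_fraction_ring iotaq) :
  forall z : Kq,
    fraction_span iotaq (mu q Delta) (fun j => mu q (g j)) z ->
    C_set iotaq (mu q Delta) z.
Proof.
have [F_ok D_ok g_ok] := q_ok.
have [D ED] := denominators_prime_to_lift q_prime D_ok.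
have [F EF] := denominators_prime_to_lift q_prime F_ok.
have [D_monic _] := DeltaP; have [_ _ gC _] := gP.
have [inj_iota unit_K _] := iotaP; have [_ unit_Kq _] := iotaqP.
have Dq0 : mred q_prime D != 0.
  by apply: (@mred_wt_monic_neq0 _ _ _ wt); rewrite ED.
have D0 : Delta != 0.
  apply: contraNneq Dq0 => De0; have -> : D = 0.
    by apply: (@mval_inj q); rewrite ED De0 raddf0.
  by rewrite raddf0.
have EDq : mu q Delta = mred q_prime D by rewrite -ED mu_mval.
have Ef : f = map_poly (mval q) (muni F).
  by rewrite -muni_map EF mmultiK.
have Efq : mu_poly q f = map_poly (mred q_prime) (muni F).
  have mu0 : mu q 0 = 0 :> {mpoly 'F_q[n]}.
    by rewrite -[0 in LHS](raddf0 (mval q)) mu_mval raddf0.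
  have Ei i : f`_i = mval q (muni F)`_i by rewrite {1}Ef coef_map.
  apply/polyP => i; transitivity (mu q f`_i).
    exact: (@coef_map_id0 _ _ (@mu q n)).
  rewrite Ei mu_mval.
  exact: esym (coef_map (mred q_prime) _ _).
have [d szf] : exists d, size f = d.+2.
  by exists (size f).-2; case: (size f) f_deg => [|[]].
have F_monic : muni F \is monic.
  apply/monicP; apply: (@mval_inj q).
  rewrite -(lead_coef_map_inj (@mval_inj q n) (raddf0 _)).
  by rewrite -Ef (monicP f_monic) rmorph1.
have fq_monic : mu_poly q f \is monic by rewrite Efq; exact: monic_map.
have szfq : size (mu_poly q f) = d.+2.
  rewrite Efq size_map_poly_id0; last first.
    by rewrite (monicP F_monic) rmorph1 oner_neq0.
  by rewrite -szf Ef (size_map_inj_poly (@mval_inj q n) (raddf0 _)).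
move=> z; apply: C_set_of_generators => j {z}.
have [G EG] := denominators_prime_to_lift q_prime (g_ok j).
have [_ int_g] : C_set iota Delta (fraction iota Delta (g j)).
  by apply/gC; exact: fraction_in_span.
have unit_D := unit_K _ (qpolyC_lreg D0).
have [N EN] := scaled_char_poly_dvd (mpoly_cic (n := n) (@field_cic rat))
  f_monic szf inj_iota D0 unit_D int_g.
have EN0 : map_poly (mval q) (scaled_char_poly d (muni F) D (muni G)) =
    mval q (D ^+ d.+1) *: N.
  have -> : mval q (D ^+ d.+1) = Delta ^+ d.+1.
    by rewrite -ED; exact: (rmorphXn (mval q)).
  rewrite -EN [LHS]map_scaled_char_poly.
  apply: (f_equal3 (scaled_char_poly d)); [exact: esym Ef | exact: ED |].
  by rewrite -EG; exact: esym (muni_map _ _).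
have [N' EN'] :
    exists N', scaled_char_poly d (muni F) D (muni G) = D ^+ d.+1 *: N'.
  apply: (@gauss_poly _ q_prime _ _ _ N); last exact: esym EN0.
  by rewrite rmorphXn expf_neq0.
have ENq : scaled_char_poly d (mu_poly q f) (mu q Delta) (muni (mu q (g j))) =
    mu q Delta ^+ d.+1 *: map_poly (mred q_prime) N'.
  have -> : mu q Delta ^+ d.+1 *: map_poly (mred q_prime) N' =
            map_poly (mred q_prime) (D ^+ d.+1 *: N').
    rewrite [RHS]map_polyZ EDq; congr (_ *: _).
    exact: esym (rmorphXn (mred q_prime) _ _).
  rewrite -EN' [RHS]map_scaled_char_poly.
  apply: (f_equal3 (scaled_char_poly d)); [exact: Efq | exact: EDq |].
  by rewrite -EG mu_mval; exact: muni_map.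
apply: (fraction_integral fq_monic szfq _ _ ENq).
  by apply: unit_Kq; apply: qpolyC_lreg; rewrite EDq.
by apply: scaled_char_poly_quotient_monic ENq; rewrite EDq.
Qed.
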